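(* Let $R$ be a ring and let $a, b \in R$. If $ab$ is strongly $J^{\#}$-clean in $R$, then $ba$ is strongly $J^{\#}$-clean in $R$.
   Context: All rings are associative with identity, not necessarily commutative. $J(R)$ denotes the Jacobson radical of $R$, and $J^{\#}(R)=\{z\in R : z^n\in J(R)\text{ for some } n\ge 1\}$ (a subset of $R$, not necessarily an ideal or subring). An element $a\in R$ is strongly $J^{\#}$-clean if $a=e+j$ for some $e\in R$ with $e^2=e$ and some $j\in J^{\#}(R)$ with $ej=je$. *)

(* Defs.v *)
From mathcomp Require Import all_boot all_algebra.
From mathcomp Require Import all_classical.

Set Implicit Arguments.
Unset Strict Implicit.
Unset Printing Implicit Defensive.

Import GRing.Theory.
Local Open Scope classical_set_scope.
Local Open Scope ring_scope.

(* The zero ring is a ring with identity, hence [pzRingType] throughout, and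
   ideals are classical (not necessarily decidable) subsets. *)

Definition left_ideal (R : pzRingType) (I : set R) : Prop :=
  [/\ I 0,
      forall x y, I x -> I y -> I (x + y) &
      forall r x, I x -> I (r * x)].

Definition maximal_left_ideal (R : pzRingType) (M : set R) : Prop :=
  [/\ left_ideal M,
      M <> setT &
      forall I : set R, left_ideal I -> M `<=` I -> I = M \/ I = setT].

(* The intersection of the maximal left ideals coincides with that of the
   maximal right ideals.  For the zero ring it is the whole ring. *)
Definition jacobson (R : pzRingType) : set R :=
  \bigcap_(M in @maximal_left_ideal R) M.
Arguments jacobson : clear implicits.

Definition jsharp (R : pzRingType) : set R :=
  [set z | exists2 n : nat, (1 <= n)%N & jacobson R (z ^+ n)].
Arguments jsharp : clear implicits.

Definition strongly_jsharp_clean (R : pzRingType) (a : R) : Prop :=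
  exists e j : R,
    [/\ a = e + j, e ^+ 2 = e, jsharp R j & e * j = j * e].

(* Main.v *)
Require Import Defs.
From mathcomp Require Import all_boot all_algebra.
From mathcomp Require Import all_classical.

(** The idempotent of [b * a] can be written down explicitly.  Let
    [c = a * b = e + j] be a strongly J#-clean decomposition.  A power of [j]
    lies in the Jacobson radical, so [u = 1 + j] has an inverse [w], and
    [c * e = e * u].  Hence [e * w] inverts [c] on the range of [e], and, as in
    Cline's formula, [f = b * (e * w) * a] is an idempotent commuting with
    [b * a].  The rest is [b * a - f = b * v * a] with [v = 1 - e * w], and
    since [c * v = c - e = j],

      [(b * v * a) ^+ n.+1 = b * v * j ^+ n * a],

    which lies in the radical as soon as [j ^+ n] does.

    Two properties of the radical, defined as the intersection of the maximal
    left ideals, carry the argument: it is closed under multiplication on the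
    right ([jacobson_mulr]), and [1 - x] is invertible for [x] in it
    ([jacobson_inv]).  The former holds because the colon [(M : r)] of a maximal
    left ideal [M] is maximal or the whole ring, the latter because Zorn's lemma
    puts every proper left ideal inside a maximal one. *)

Set Implicit Arguments.
Unset Strict Implicit.
Unset Printing Implicit Defensive.

Import GRing.Theory.
Local Open Scope classical_set_scope.
Local Open Scope ring_scope.

(** * Maximal left ideals *)

Lemma left_ideal_setT (R : pzRingType) (I : set R) :
  left_ideal I -> I 1 -> I = setT.
Proof.
move=> [_ _ IM] I1; apply/seteqP; split=> // x _.
by rewrite -[x]mulr1; exact: IM.
Qed.

Lemma left_ideal_principal (R : pzRingType) (x : R) :
  left_ideal [set y | exists s, y = s * x].
Proof.
split=> [|_ _ [s ->] [t ->]|r _ [s ->]]; first by exists 0; rewrite mul0r.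
- by exists (s + t); rewrite mulrDl.
- by exists (r * s); rewrite mulrA.
Qed.

Lemma left_ideal_add (R : pzRingType) (I K : set R) :
  left_ideal I -> left_ideal K ->
  left_ideal [set y | exists i k, [/\ I i, K k & y = i + k]].
Proof.
move=> [I0 ID IM] [K0 KD KM]; split.
- by exists 0, 0; rewrite addr0.
- move=> _ _ [i [k [Ii Kk ->]]] [i' [k' [Ii' Kk' ->]]].
  exists (i + i'), (k + k'); split; [exact: ID|exact: KD|].
  by rewrite addrACA.
- move=> r _ [i [k [Ii Kk ->]]].
  exists (r * i), (r * k); split; [exact: IM|exact: KM|].
  by rewrite mulrDr.
Qed.

Lemma left_ideal_sub_maximal (R : pzRingType) (I : set R) :
  left_ideal I -> ~ I 1 -> exists2 M, maximal_left_ideal M & I `<=` M.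
Proof.
move=> Iid I1.
(* The empty set is admitted because Zorn's lemma is applied to chains that may
   be empty; a maximal member is nonempty, as [I] itself is a member. *)
pose P := [set A : set R | A = set0 \/ [/\ left_ideal A, I `<=` A & ~ A 1]].
have [F FP Ftot|A [PA Amax]] := @Zorn_bigcup R P.
  have [[B [FB B0]]|Fnone] := pselect (exists B, F B /\ B <> set0); last first.
    left; apply/seteqP; split=> // x [X FX Xx].
    by case: Fnone; exists X; split=> // X0; move: Xx; rewrite X0.
  have FPin X x : F X -> X x -> [/\ left_ideal X, I `<=` X & ~ X 1].
    by move=> FX Xx; case: (FP X FX) => // X0; move: Xx; rewrite X0.
  have [//|[Bid IB _]] := FP B FB.
  right; split; last 2 first.
  - by move=> x Ix; exists B => //; exact: IB.
  - by move=> [X FX X1]; have [_ _] := FPin X 1 FX X1.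
  split=> [|x y [X FX Xx] [Y FY Yy]|r x [X FX Xx]].
  - by exists B => //; have [] := Bid.
  - have [[_ XD _] _ _] := FPin _ _ FX Xx.
    have [[_ YD _] _ _] := FPin _ _ FY Yy.
    have [XY|YX] := Ftot X Y FX FY.
      by exists Y => //; apply: YD => //; exact: XY.
    by exists X => //; apply: XD => //; exact: YX.
  - have [[_ _ XM] _ _] := FPin _ _ FX Xx.
    by exists X => //; exact: XM.
have [A0|[Aid IA A1]] := PA.
  have AI : A `<` I.
    by rewrite A0; split=> [x []|I0]; have [/I0] := Iid.
  by case: (Amax I AI); right; split.
exists A => //; split=> // [AT|K Kid AK]; first by apply: A1; rewrite AT.
have [K1|K1] := pselect (K 1); first by right; exact: left_ideal_setT.
left; apply: contrapT => KA.
have ltAK : A `<` K by split=> // KsubA; apply: KA; apply/seteqP.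
by case: (Amax K ltAK); right; split=> //; exact: subset_trans AK.
Qed.

(** Right multiplication by [r] embeds [R / (M : r)] into the simple module
    [R / M] with a nonzero image, since [M] does not contain [r]; so
    [R / (M : r)] is simple as well. *)
Lemma maximal_left_ideal_colon (R : pzRingType) (M : set R) (r : R) :
  maximal_left_ideal M -> ~ M r -> maximal_left_ideal [set y | M (y * r)].
Proof.
move=> [Mid _ Mmax] Mr; have [M0 MD MM] := Mid; split.
- split=> [|x y Mx My|s x Mx] /=; first by rewrite mul0r.
    by rewrite mulrDl; exact: MD.
  by rewrite -mulrA; exact: MM.
- move=> colonT; apply: Mr; rewrite -[r]mul1r.
  by rewrite -[M _]/([set y | M (y * r)] 1) colonT.
move=> I Iid colonI; have [I0 ID IM] := Iid.
have [Icolon|] := pselect (I `<=` [set y | M (y * r)]).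
  by left; apply/seteqP.
move=> /existsNP[z /not_implyP[Iz Mzr]]; right; apply/seteqP; split=> // y _.
have [|E|sumT] :=
    Mmax _ (left_ideal_add Mid (left_ideal_principal (z * r))).
- by move=> m Mm; exists m, 0; split; [|exists 0; rewrite mul0r|rewrite addr0].
- case: Mzr; rewrite /= -E; exists 0, (z * r).
  by split; [|exists 1; rewrite mul1r|rewrite add0r].
have : [set: R] (y * r) by [].
rewrite -sumT => -[m [_ [Mm [s ->] yrE]]].
rewrite -[y](subrK (s * z)); apply: ID; last exact: IM.
by apply: colonI; rewrite /= mulrBl yrE mulrA addrK.
Qed.

(** * The Jacobson radical *)

Lemma jacobson_mull (R : pzRingType) (r x : R) :
  jacobson R x -> jacobson R (r * x).
Proof.
by move=> Jx M Mmax; have [[_ _ MM] _ _] := Mmax; apply: MM; exact: Jx.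
Qed.

Lemma jacobson_mulr (R : pzRingType) (r x : R) :
  jacobson R x -> jacobson R (x * r).
Proof.
move=> Jx M Mmax; have [Mr|Mr] := pselect (M r).
  by have [[_ _ MM] _ _] := Mmax; exact: MM.
exact: Jx (maximal_left_ideal_colon Mmax Mr).
Qed.

Lemma jacobson_linv (R : pzRingType) (x : R) :
  jacobson R x -> exists w, w * (1 - x) = 1.
Proof.
move=> Jx; apply: contrapT => noinv.
have [|M Mmax subM] :=
    left_ideal_sub_maximal (left_ideal_principal (1 - x)).
  by move=> [w w1]; apply: noinv; exists w.
have [Mid MT _] := Mmax; apply: MT; apply: left_ideal_setT => //.
have [_ MD _] := Mid; rewrite -[1](subrK x); apply: MD; last exact: Jx.
by apply: subM; exists 1; rewrite mul1r.
Qed.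

(** A left inverse [w] of [1 - x] equals [1 - (- w * x)], so it has a left
    inverse too, which makes it a two-sided inverse. *)
Lemma jacobson_inv (R : pzRingType) (x : R) :
  jacobson R x -> exists w, w * (1 - x) = 1 /\ (1 - x) * w = 1.
Proof.
move=> Jx; have [w w1] := jacobson_linv Jx.
have wE : w = 1 - (- w * x).
  by rewrite mulNr opprK -[in X in X + _]w1 mulrBr mulr1 subrK.
have [t] := jacobson_linv (jacobson_mull (- w) Jx); rewrite -wE => t1.
exists w; split=> //.
by rewrite -[1 - x]mul1r -{1}t1 -(mulrA t) w1 mulr1.
Qed.

(** The geometric sum [s] of the powers of [- j] gives
    [(1 + j) * s = 1 - (- j) ^+ n], which is invertible once [j ^+ n] lies in
    the radical; and [s] commutes with [1 + j]. *)
Lemma jsharp_inv (R : pzRingType) (j : R) :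
  jsharp R j -> exists w, w * (1 + j) = 1 /\ (1 + j) * w = 1.
Proof.
move=> [n _ Jjn].
have /jacobson_inv[q [q1 q2]] : jacobson R ((- j) ^+ n).
  by rewrite exprNn; exact: jacobson_mull.
pose s := \sum_(i < n) (- j) ^+ i.
have us : (1 + j) * s = 1 - (- j) ^+ n.
  by rewrite -opprB subrX1 -mulNr opprB opprK.
have su : s * (1 + j) = (1 + j) * s.
  apply/esym/commr_sum => i _; apply/commrX/commrN/commr_sym.
  by apply: commrD; [exact: commr1|].
have ql : q * s * (1 + j) = 1 by rewrite -mulrA su us.
have qr : (1 + j) * (s * q) = 1 by rewrite mulrA us.
exists (s * q); split=> //.
by rewrite -[s * q]mul1r -{1}ql -(mulrA (q * s)) qr mulr1.
Qed.

(** * Transfer from [a * b] to [b * a] *)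

Lemma comm_inv (R : pzRingType) (u w x : R) :
  w * u = 1 -> u * w = 1 -> GRing.comm u x -> GRing.comm w x.
Proof.
move=> wu uw ux.
by rewrite /GRing.comm -[x in LHS]mulr1 -uw !mulrA -(mulrA w) -ux mulrA wu mul1r.
Qed.

Lemma exprS_sandwich (R : pzRingType) (a b v : R) (n : nat) :
  (b * v * a) ^+ n.+1 = b * v * (a * b * v) ^+ n * a.
Proof.
elim: n => [|n IHn]; first by rewrite expr0 mulr1 expr1.
by rewrite exprSr IHn [in RHS]exprSr !mulrA.
Qed.

Theorem theorem2p16 (R : pzRingType) (a b : R) :
  strongly_jsharp_clean (a * b) -> strongly_jsharp_clean (b * a).
Proof.
move=> [e [j [cE ee Jj ej]]].
have [w [wu uw]] := jsharp_inv Jj.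
have [n _ Jjn] := Jj.
have we : GRing.comm w e.
  apply: comm_inv wu uw _; apply/commr_sym/commrD; first exact: commr1.
  exact: ej.
have wc : GRing.comm w (a * b).
  apply: comm_inv wu uw _; apply/commr_sym/commrD; first exact: commr1.
  rewrite cE; apply/commr_sym/commrD; [exact: esym|by []].
have ec : GRing.comm e (a * b) by rewrite cE; apply: commrD.
have cew : a * b * (e * w) = e.
  by rewrite mulrA -ec cE mulrDr -expr2 ee -{1}[e]mulr1 -mulrDr -mulrA uw mulr1.
have ewc : e * w * (a * b) = a * b * (e * w).
  by rewrite -mulrA wc mulrA ec -mulrA.
pose v := 1 - e * w.
have cv : a * b * v = j by rewrite mulrBr mulr1 cew cE addrC addKr.
have kE : b * a - b * (e * w) * a = b * v * a by rewrite mulrBr mulr1 mulrBl.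
exists (b * (e * w) * a), (b * v * a); split.
- by rewrite -kE addrC subrK.
- by rewrite exprS_sandwich expr1 cew -(mulrA b) -we -(mulrA w) -expr2 ee we.
- exists n.+1 => //; rewrite exprS_sandwich cv.
  by apply: jacobson_mulr; exact: jacobson_mull.
- rewrite -kE; apply: commrB; last by [].
  rewrite /GRing.comm.
  have -> : b * (e * w) * a * (b * a) = b * (e * w * (a * b)) * a.
    by rewrite !mulrA.
  by rewrite ewc !mulrA.
Qed.
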